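(* For every nonnegative integer $a$, \[ P(\mathrm{Paw}_a,1)=\frac16-\frac1{a+3}+\frac1{a+1},\qquad P(\mathrm{Di}_a,1)=\frac3{10}-\frac2{a+4}+\frac2{a+2},\qquad P((K_4)_a,1)=\frac25-\frac3{a+5}+\frac3{a+3}. \]
   Context: Forest building process: given a finite graph $G$ and a linear ordering of its edges, go through the edges in order and keep an edge if and only if at least one of its endpoints is not an endpoint of any earlier edge in the ordering (earlier edges count whether or not they were kept). The kept edges form a forest. $P(G,k)$ denotes the probability that, for a uniformly random ordering of the edges of $G$, the resulting forest has exactly $k$ trees. The paw graph is a triangle with one pendant edge attached to one triangle vertex; $\mathrm{Paw}_a$ is the paw graph with $a$ new leaves attached to its vertex of degree $1$. The diamond graph is $K_4$ minus one edge (a four-cycle plus one chord); $\mathrm{Di}_a$ is the diamond with $a$ new leaves attached to one of its vertices of degree $2$. $(K_4)_a$ is the complete graph $K_4$ with $a$ new leaves attached to one of its vertices. *)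

(* Defs.v *)
From HB Require Import structures.
From mathcomp Require Import all_boot all_order all_algebra.

Set Implicit Arguments.
Unset Strict Implicit.
Unset Printing Implicit Defensive.

Import Order.TTheory GRing.Theory Num.Theory.

Record sgraph := SGraph {
  vertex : finType;
  adj : rel vertex;
  adj_sym : symmetric adj;
  adj_irr : irreflexive adj }.

Definition edges (G : sgraph) : {set {set vertex G}} :=
  [set [set p.1; p.2] | p : vertex G * vertex G & adj p.1 p.2].

Definition kept (G : sgraph) (s : seq {set vertex G}) : {set {set vertex G}} :=
  [set e in s | [exists v in e,
                   all (fun f : {set vertex G} => v \notin f)
                       (take (index e s) s)]].

(* The forest is spanning: an isolated vertex of G would count as a tree.     *)
Definition num_trees (G : sgraph) (s : seq {set vertex G}) : nat :=
  n_comp (fun x y : vertex G => [set x; y] \in kept s) predT.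

(* The linear orderings of the edges are the duplicate-free sequences listing *)
(* them, i.e. the elements of permutations (enum (edges G)).                  *)
Definition orderings (G : sgraph) : seq (seq {set vertex G}) :=
  permutations (enum (edges G)).

Definition P (G : sgraph) (k : nat) : rat :=
  ((count (fun s => num_trees s == k) (orderings G))%:R
   / (size (orderings G))%:R)%R.

Section AddLeaves.
Variables (G : sgraph) (v : vertex G) (a : nat).

Definition leaves_adj (x y : vertex G + 'I_a) : bool :=
  match x, y with
  | inl x, inl y => adj x y
  | inl x, inr _ => x == v
  | inr _, inl y => y == v
  | inr _, inr _ => false
  end.

Fact leaves_adj_sym : symmetric leaves_adj.
Proof. by move=> [x|i] [y|j] //=; rewrite adj_sym. Qed.

Fact leaves_adj_irr : irreflexive leaves_adj.
Proof. by move=> [x|i] //=; rewrite adj_irr. Qed.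

Definition add_leaves : sgraph := SGraph leaves_adj_sym leaves_adj_irr.

End AddLeaves.

Section FourVertices.
Variable s : seq (nat * nat).

Definition pairs_adj (x y : 'I_4) : bool :=
  (x != y) && (((val x, val y) \in s) || ((val y, val x) \in s)).

Fact pairs_adj_sym : symmetric pairs_adj.
Proof. by move=> x y; rewrite /pairs_adj eq_sym orbC. Qed.

Fact pairs_adj_irr : irreflexive pairs_adj.
Proof. by move=> x; rewrite /pairs_adj eqxx. Qed.

Definition graph4 : sgraph := SGraph pairs_adj_sym pairs_adj_irr.

End FourVertices.

(* Triangle 0 1 2 with the pendant edge 2 3; vertex 3 has degree 1.           *)
Definition paw : sgraph := graph4 [:: (0, 1); (1, 2); (0, 2); (2, 3)].

(* Four-cycle 0 1 2 3 with the chord 1 3; vertices 0 and 2 have degree 2.     *)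
Definition diamond : sgraph :=
  graph4 [:: (0, 1); (1, 2); (2, 3); (0, 3); (1, 3)].

Definition K4 : sgraph :=
  graph4 [:: (0, 1); (0, 2); (0, 3); (1, 2); (1, 3); (2, 3)].

Definition Paw (a : nat) : sgraph := @add_leaves paw (ord_max : 'I_4) a.
Definition Di (a : nat) : sgraph := @add_leaves diamond (ord0 : 'I_4) a.
Definition K4_leaves (a : nat) : sgraph := @add_leaves K4 (ord0 : 'I_4) a.

(* Main.v *)
(* The forest is a single tree iff every edge but the first meets an earlier
   edge. A leaf edge other than the first may therefore come only once its
   attachment vertex v is covered, and from then on leaf edges are
   unconstrained. So a valid ordering of the m base edges, in which v is first
   covered with k base edges still to come, extends to (k + a)! / k! valid
   orderings starting with a base edge; those starting with a leaf edge number
   a (m + a - 1)! / m! times the valid base orderings starting from {v}. What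
   remains is a finite enumeration of the orderings of at most six edges. *)
Require Import Defs.
From HB Require Import structures.
From mathcomp Require Import all_boot all_order all_algebra.
From mathcomp Require Import ring zify.

Set Implicit Arguments.
Unset Strict Implicit.
Unset Printing Implicit Defensive.

Import Order.TTheory GRing.Theory Num.Theory.
Local Open Scope ring_scope.

(** * Linked orderings and one-tree forests *)

(* C is the set of vertices covered before s. *)
Fixpoint linked (W : finType) (C : {set W}) (s : seq {set W}) : bool :=
  if s is e :: s' then ~~ [disjoint e & C] && linked (C :|: e) s' else true.

Definition chained (W : finType) (s : seq {set W}) : bool :=
  if s is e :: s' then linked e s' else true.

(** The witness [x0] rules out the empty type, which has 0 components although all its points are
    vacuously connected. *)
Lemma n_comp_eq1P (T : finType) (r : rel T) (x0 : T) :
  connect_sym r -> reflect (forall x y, connect r x y) (n_comp r predT == 1%N).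
Proof.
move=> rC; apply: (iffP eqP) => [n1 x y|rT]; last first.
  by rewrite -(n_comp_connect rC x0); apply: eq_n_comp_r => y; rewrite !inE rT.
rewrite -(root_connect rC); apply/eqP.
have /card_le1_eqP: (#|predI (roots r) (mem predT)| <= 1)%N by rewrite -n1.
by apply; rewrite !inE ?andbT roots_root.
Qed.

Lemma mem_edge (G : sgraph) (x y : vertex G) :
  adj x y -> [set x; y] \in edges G.
Proof. by move=> xy; apply/imsetP; exists (x, y); rewrite ?inE. Qed.

Section OneTree.
Variables (G : sgraph) (s : seq {set vertex G}).
Hypothesis s_ord : perm_eq s (enum (edges G)).
Local Notation cov p := (\bigcup_(f <- p) f).
Local Notation ktree := (fun x y : vertex G => [set x; y] \in kept s).

Lemma mem_cov (p : seq {set vertex G}) v :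
  (v \in cov p) = has (fun f : {set vertex G} => v \in f) p.
Proof.
by elim: p => [|e p IHp]; rewrite ?big_nil ?inE // big_cons inE IHp.
Qed.

Lemma cov_rcons (p : seq {set vertex G}) e : cov (rcons p e) = cov p :|: e.
Proof. by rewrite -cats1 big_cat big_seq1. Qed.

Let s_uniq : uniq s.
Proof. by rewrite (perm_uniq s_ord) enum_uniq. Qed.

Let edgeP e : e \in s -> exists x y, e = [set x; y].
Proof.
by rewrite (perm_mem s_ord) mem_enum => /imsetP[[x y] _ ->]; exists x, y.
Qed.

(** Since [s] has no duplicates, [e] occurs first right after [p], so the edges earlier than [e] are
    exactly those of [p]. *)
Lemma kept_cat p e q :
  s = p ++ e :: q -> (e \in kept s) = [exists v in e, v \notin cov p].
Proof.
move=> def_s; have e_p : e \notin p.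
  by move: s_uniq; rewrite def_s cat_uniq /= negb_or => /and3P[_ /andP[]].
rewrite inE def_s mem_cat mem_head orbT /= index_cat (negPf e_p) /= eqxx addn0.
rewrite take_size_cat //; apply: eq_existsb => v.
by rewrite mem_cov -all_predC.
Qed.

Lemma ktree_sym : connect_sym ktree.
Proof. by apply: sym_connect_sym => x y; rewrite setUC. Qed.

(** The next edge meets the covered set in some [z]. If its other end is new, the edge is kept and
    joins that end to [z]; otherwise nothing new is covered. Either way the covered set stays
    connected by kept edges. *)
Lemma linked_connect p q :
  s = p ++ q -> linked (cov p) q ->
  {in cov p &, forall x y, connect ktree x y} ->
  {in cov s &, forall x y, connect ktree x y}.
Proof.
elim: q p => [|e q IHq] p def_s /=; first by rewrite def_s cats0.
case/andP=> /pred0Pn[z /andP[/= z_e z_p]] link_q conn_p.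
apply: (IHq (rcons p e)); rewrite ?cat_rcons ?cov_rcons //.
suffices conn_z: {in cov p :|: e, forall x, connect ktree z x}.
  by move=> x y /conn_z zx /conn_z; apply: connect_trans; rewrite ktree_sym.
move=> w; rewrite inE; have [w_p _ | w_p /= w_e] := boolP (w \in cov p).
  exact: conn_p.
apply/connect1; suffices ->: [set z; w] = e.
  by rewrite (kept_cat def_s); apply/existsP; exists w; rewrite w_e.
have [x [y def_e]]: exists x y, e = [set x; y].
  by apply: edgeP; rewrite def_s mem_cat mem_head orbT.
have z'w: z != w by apply: contraNneq w_p => <-.
move: z_e w_e z'w; rewrite def_e !inE.
case/orP=> /eqP-> /orP[] /eqP->; rewrite ?eqxx // => _.
by rewrite setUC.
Qed.

(* Colour each new vertex like the old endpoint of the edge covering it. *)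
Lemma extend_coloring p q (c : vertex G -> bool) :
  s = p ++ q ->
  (forall x y, [set x; y] \in p -> ktree x y -> c x = c y) ->
  exists2 c', {in cov p, c' =1 c} & forall x y, ktree x y -> c' x = c' y.
Proof.
elim: q p c => [|e q IHq] p c def_s c_p.
  exists c => // x y kxy; apply: c_p => //.
  by move: kxy; rewrite inE def_s cats0 => /andP[].
(* If [e] meets no earlier edge, both its ends are new and [true] is an arbitrary common colour for
   them. *)
pose b := if [pick z in e :&: cov p] is Some z then c z else true.
pose c1 w := if w \in cov p then c w else b.
have c1_p : {in cov p, c1 =1 c} by move=> w; rewrite /c1 => ->.
have [||c' c'_c1 c'_k] := IHq (rcons p e) c1; rewrite ?cat_rcons //.
  move=> x y; rewrite mem_rcons inE => /orP[/eqP def_e | xy_p] kxy; last first.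
    by rewrite !c1_p; [exact: c_p | |]; rewrite mem_cov; apply/hasP;
      exists [set x; y]; rewrite ?inE ?eqxx ?orbT.
  move: kxy; rewrite def_e (kept_cat def_s) => /existsP[v /andP[]].
  rewrite /c1 /b; case: pickP => [z|no_z].
    rewrite -def_e !inE => /andP[/orP[] /eqP-> z_p] /orP[] /eqP-> v_p.
    - by rewrite z_p in v_p.
    - by rewrite z_p (negPf v_p).
    - by rewrite z_p (negPf v_p).
    - by rewrite z_p in v_p.
  have:= (no_z x, no_z y); rewrite -def_e !inE !eqxx orbT /=.
  by case=> -> ->.
exists c' => // w w_p; rewrite c'_c1 ?c1_p // cov_rcons inE w_p //.
Qed.

(* An edge e meeting no earlier edge starts a second tree: colour the vertices
   covered before e differently from the ends of e. *)
Lemma unlinked_coloring p q :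
  s = p ++ q -> cov p != set0 -> ~~ linked (cov p) q ->
  exists2 c : vertex G -> bool, forall x y, ktree x y -> c x = c y
                              & exists x y, c x != c y.
Proof.
elim: q p => [|e q IHq] //= p def_s p_n0; rewrite negb_and negbK.
case/orP=> [dis_e | unlink_q]; last first.
  apply: (IHq (rcons p e)); rewrite ?cat_rcons ?cov_rcons //.
  by apply: contraNneq p_n0 => /eqP; rewrite setU_eq0 => /andP[].
have [||c c_w c_k] := @extend_coloring (rcons p e) q (fun w => w \in cov p).
- by rewrite cat_rcons.
- move=> x y; rewrite mem_rcons inE => /orP[/eqP def_e | xy_p] _.
    by rewrite !(disjointFr dis_e) // -def_e !inE eqxx ?orbT.
  by rewrite !mem_cov; transitivity true; [|symmetry];
    apply/hasP; exists [set x; y]; rewrite ?inE ?eqxx ?orbT.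
exists c => //.
have [x [y def_e]]: exists x y, e = [set x; y].
  by apply: edgeP; rewrite def_s mem_cat mem_head orbT.
have [z z_p] := set0Pn _ p_n0; have x_e: x \in e by rewrite def_e !inE eqxx.
by exists z, x; rewrite !c_w ?cov_rcons ?inE ?z_p ?x_e ?orbT //
  (disjointFr dis_e).
Qed.

(** Without isolated vertices the whole ordering covers every vertex. A chained ordering then
    connects all of them, while an unchained one admits a nonconstant colouring that is constant
    along kept edges, hence on components. *)
Lemma num_trees_eq1 (x0 : vertex G) :
  (forall x : vertex G, exists y, adj x y) -> (num_trees s == 1%N) = chained s.
Proof.
move=> no_isolated.
have cov_s: cov s = setT.
  apply/setP=> x; have [y xy] := no_isolated x.
  rewrite mem_cov inE; apply/hasP; exists [set x; y]; last by rewrite !inE eqxx.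
  by rewrite (perm_mem s_ord) mem_enum mem_edge.
have [e [q def_s]]: exists e q, s = e :: q.
  case: (s) cov_s => [|e q _]; last by exists e, q.
  by rewrite big_nil => /setP/(_ x0); rewrite !inE.
have [x [y def_e]] : exists x y, e = [set x; y].
  by apply: edgeP; rewrite def_s mem_head.
have e_n0 : e != set0.
  by rewrite def_e; apply/set0Pn; exists x; rewrite !inE eqxx.
have def_s' : s = [:: e] ++ q by [].
have chain_s : chained s = linked e q by rewrite def_s.
rewrite chain_s; apply/(n_comp_eq1P x0 ktree_sym)/idP => [conn | link_q].
  apply: contraT => unlink_q.
  have [||c c_k [z [w]]] := @unlinked_coloring [:: e] q def_s';
    rewrite ?big_seq1 //.
  have cl : closed ktree c by move=> u v /c_k.
  by case/eqP; apply: (closed_connect cl).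
move=> z w; apply: (@linked_connect [:: e] q def_s'); rewrite ?cov_s ?inE //.
  by rewrite big_seq1.
have kxy: ktree x y.
  rewrite -def_e (@kept_cat [::] e q) //; apply/existsP; exists x.
  by rewrite def_e !inE eqxx big_nil inE.
move=> u v; rewrite big_seq1 def_e !inE => /orP[]/eqP-> /orP[]/eqP-> //.
  exact: connect1.
by rewrite ktree_sym connect1.
Qed.

End OneTree.

(** * Edges after adding leaves, and their traces on the base graph *)

Section Leaves.
Variables (G : sgraph) (v : vertex G) (a : nat).
Local Notation G' := (add_leaves v a).
Local Notation V' := (vertex G + 'I_a)%type.

Definition base_edge (e : {set vertex G}) : {set V'} := inl @: e.
Definition leaf_edge (i : 'I_a) : {set V'} := [set inl v; inr i].
Definition trace (e : {set V'}) : {set vertex G} := [set x | inl x \in e].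

Lemma base_edgeK e : trace (base_edge e) = e.
Proof. by apply/setP=> x; rewrite inE mem_imset // => ? ? []. Qed.

Lemma base_edge_inj : injective base_edge.
Proof. exact: can_inj base_edgeK. Qed.

Lemma trace_leaf_edge i : trace (leaf_edge i) = [set v].
Proof. by apply/setP=> x; rewrite !inE orbF. Qed.

Lemma leaf_edge_inj : injective leaf_edge.
Proof. by move=> i j /setP/(_ (inr i)); rewrite !inE eqxx => /esym/eqP[]. Qed.

Lemma perm_edges_add_leaves :
  perm_eq (enum (edges G'))
          (map base_edge (enum (edges G)) ++ map leaf_edge (enum 'I_a)).
Proof.
apply: uniq_perm; first exact: enum_uniq.
  rewrite cat_uniq (map_inj_uniq base_edge_inj) (map_inj_uniq leaf_edge_inj).
  rewrite !enum_uniq andbT /=.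
  apply/hasPn=> _ /mapP[i _ ->]; apply/mapP=> -[e _ /setP/(_ (inr i))].
  by rewrite !inE eqxx => /esym/imsetP[].
have adj_base (x y : vertex G) : [set inl x; inl y] = base_edge [set x; y].
  by rewrite /base_edge imsetU1 imset_set1.
move=> e; rewrite mem_enum mem_cat; apply/imsetP/orP.
  case=> -[[x|i] [y|j]]; rewrite inE //=.
  - move=> xy ->; left; rewrite adj_base map_f // mem_enum.
    exact: mem_edge.
  - by move/eqP=> -> ->; right; apply/mapP; exists j; rewrite ?mem_enum.
  - by move/eqP=> -> ->; right; rewrite setUC; apply/mapP; exists i;
      rewrite ?mem_enum.
case=> /mapP[].
  move=> f; rewrite mem_enum => /imsetP[[x y]]; rewrite inE /= => xy -> ->.
  by exists (inl x, inl y); rewrite ?inE -?adj_base.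
by move=> i _ ->; exists (inl v, inr i); rewrite ?inE /=.
Qed.

Lemma leaf_in_edge e i : e \in edges G' -> inr i \in e -> e = leaf_edge i.
Proof.
rewrite -mem_enum (perm_mem perm_edges_add_leaves) mem_cat.
case/orP=> /mapP[f _ ->]; first by case/imsetP.
by rewrite !inE /= => /eqP[->].
Qed.

(** A leaf lies on one edge only, so an edge never meets the earlier cover in a leaf. Whether it
    meets that cover is decided on the base vertices. *)
Lemma linked_trace (C : {set V'}) s :
  uniq s -> {subset s <= edges G'} ->
  (forall (e : {set V'}) i, e \in s -> inr i \in e -> inr i \notin C) ->
  linked C s = linked (trace C) (map trace s).
Proof.
elim: s C => //= e s IHs C /andP[e_s s_u] sE sC.
have sE1: {subset s <= edges G'} by move=> f fs; apply: sE; rewrite inE fs orbT.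
congr (~~ _ && _).
  apply/pred0P/pred0P=> dis x; first by have:= dis (inl x); rewrite /= !inE.
  case: x => [x|i]; first by have:= dis x; rewrite /= !inE.
  apply/negbTE/negP=> /andP[/= ie iC].
  by have /negP := sC e i (mem_head _ _) ie.
have ->: trace C :|: trace e = trace (C :|: e) by apply/setP=> x; rewrite !inE.
apply: IHs => // f i fs if_; rewrite inE negb_or (sC f) ?inE ?fs ?orbT //=.
(* If [e] and a later [f] shared the leaf [i], both would be [leaf_edge i], against [uniq]. *)
apply: contra e_s => ie.
have e_in : e \in edges G' by apply: sE; rewrite mem_head.
by rewrite (leaf_in_edge e_in ie) -(leaf_in_edge (sE1 _ fs) if_).
Qed.

Lemma chained_trace s :
  perm_eq s (enum (edges G')) -> chained s = chained (map trace s).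
Proof.
move=> s_ord; have: uniq s by rewrite (perm_uniq s_ord) enum_uniq.
have: {subset s <= edges G'} by move=> e; rewrite (perm_mem s_ord) mem_enum.
case: s {s_ord} => //= e s sE /andP[e_s s_u].
have sE1: {subset s <= edges G'} by move=> f fs; apply: sE; rewrite inE fs orbT.
apply: linked_trace => // f i fs if_; apply: contra e_s => ie.
have e_in : e \in edges G' by apply: sE; rewrite mem_head.
by rewrite (leaf_in_edge e_in ie) -(leaf_in_edge (sE1 _ fs) if_).
Qed.

End Leaves.

(** * Sums over permutations, split by the first element *)

Section SumPermutations.
Local Open Scope nat_scope.

Lemma perm_rem (T : eqType) (x : T) (s t : seq T) :
  perm_eq (x :: t) s -> perm_eq (rem x s) t.
Proof.
move=> st; have xs: x \in s by rewrite -(perm_mem st) mem_head.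
by rewrite -(perm_cons x) perm_sym (perm_trans st) // perm_to_rem.
Qed.

Lemma sum_permutations (T : eqType) (s : seq T) (F : seq T -> nat) :
  uniq s -> 0 < size s ->
  \sum_(t <- permutations s) F t =
  \sum_(x <- s) \sum_(t <- permutations (rem x s)) F (x :: t).
Proof.
move=> s_u s_gt0; rewrite (perm_big _ (permutationsE s_gt0)) undup_id //.
exact: big_allpairs_dep.
Qed.

Lemma sum_permutations_cat (T : eqType) (b l : seq T) (F : seq T -> nat) :
  uniq (b ++ l) -> 0 < size b + size l ->
  \sum_(s <- permutations (b ++ l)) F s =
  \sum_(x <- b) \sum_(s <- permutations (rem x b ++ l)) F (x :: s) +
  \sum_(x <- l) \sum_(s <- permutations (b ++ rem x l)) F (x :: s).
Proof.
move=> bl_u bl_gt0; rewrite sum_permutations ?size_cat // big_cat.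
congr (_ + _); apply: eq_big_seq => x xs; apply: perm_big.
  apply/perm_permutations/perm_rem.
  by rewrite -cat_cons perm_cat2r perm_sym perm_to_rem.
apply/perm_permutations/perm_rem; rewrite perm_sym.
by rewrite -[x :: _]cat1s perm_sym perm_catCA perm_cat2l perm_sym perm_to_rem.
Qed.

Lemma sum_permutations_map (T U : eqType) (h : T -> U) (s : seq T)
    (F : seq U -> nat) :
  uniq (map h s) ->
  \sum_(t <- permutations (map h s)) F t =
  \sum_(t <- permutations s) F (map h t).
Proof.
have [n] := ubnP (size s); elim: n s F => // n IHn s F s_n hs_u.
case: (posnP (size s)) => [/size0nil-> | s_gt0].
  by rewrite !big_seq1.
have s_u := map_uniq hs_u.
rewrite !sum_permutations ?size_map // big_map; apply: eq_big_seq => x xs.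
have hs_rem: perm_eq (rem (h x) (map h s)) (map h (rem x s)).
  by apply: perm_rem; rewrite -map_cons perm_map // perm_sym perm_to_rem.
rewrite (perm_big _ (perm_permutations hs_rem)).
rewrite (IHn _ (fun t => F (h x :: t))) //.
  by rewrite size_rem // -ltnS prednK.
by rewrite -(perm_uniq hs_rem) rem_uniq.
Qed.

End SumPermutations.

(** * Inserting leaf edges into orderings of the base edges *)

Section FreeLeaves.
Local Open Scope nat_scope.
Variables (T : eqType) (W : finType) (tr : T -> {set W}) (v : W).

(** Pascal's rule multiplied by [k.+1]!. The two summands will correspond to a base edge or a leaf
    edge coming first. *)
Lemma ffact_pascal n k : (n.+1 + k.+1) ^_ k.+1 =
  (n + k.+1) ^_ k.+1 + k.+1 * (n.+1 + k) ^_ k.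
Proof.
by rewrite (addSnnS n k) -!bin_ffact addSn binS mulnDl [in RHS]mulnCA -factS.
Qed.

(** Once [v] is covered, a leaf edge always meets the cover and adds nothing to it, so leaf edges
    may be interleaved freely. The falling factorial counts the interleavings of distinct leaf
    edges: these are labels in [T], distinct although their traces coincide. *)
Lemma sum_linked_covered (C : {set W}) (b l : seq T) :
  v \in C -> uniq (b ++ l) -> {in l, forall x, tr x = [set v]} ->
  \sum_(s <- permutations (b ++ l)) linked C (map tr s) =
  (size b + size l) ^_ (size l) *
    \sum_(s <- permutations b) linked C (map tr s).
Proof.
have [n] := ubnP (size b + size l); elim: n C b l => // n IHn C b l.
move=> bl_n vC bl_u l_v.
case: (posnP (size l)) => [l0 | l_gt0].
  by rewrite (size0nil l0) cats0 ffactn0 mul1n.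
have b_u : uniq b by move: bl_u; rewrite cat_uniq => /andP[].
have leaf x : x \in l ->
  \sum_(s <- permutations (b ++ rem x l)) linked C (map tr (x :: s)) =
  (size b + (size l).-1) ^_ (size l).-1 *
    \sum_(s <- permutations b) linked C (map tr s).
  move=> xl; have C1 : C :|: tr x = C.
    by rewrite l_v // setUC; apply/setUidPr; rewrite sub1set.
  have meet : ~~ [disjoint tr x & C] by rewrite l_v // disjoints1 vC.
  under eq_bigr do rewrite /= meet C1 /=.
  rewrite IHn // ?size_rem //.
  - by rewrite -ltnS -addnS prednK.
  - by rewrite (subseq_uniq _ bl_u) // cat_subseq ?rem_subseq.
  - by move=> y /mem_rem/l_v.
rewrite sum_permutations_cat //; last by rewrite addn_gt0 l_gt0 orbT.
rewrite [X in _ + X](eq_big_seq _ leaf) [X in _ + X]big_const_seq.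
rewrite count_predT iter_addn_0.
(* Splitting by the first element requires a nonempty list, so an empty [b] is treated apart; both
   sides then reduce to the factorial of [size l]. *)
case: (posnP (size b)) => [/size0nil b0 | b_gt0].
  rewrite b0 big_nil /= !add0n mulnAC mulnC !ffactnn.
  by rewrite mulnC -[in RHS](prednK l_gt0) factS prednK // (mulnC (size l)).
have sum_b := sum_permutations (fun s => linked C (map tr s) : nat) b_u b_gt0.
have edge x : x \in b ->
  \sum_(s <- permutations (rem x b ++ l)) linked C (map tr (x :: s)) =
  ((size b).-1 + size l) ^_ (size l) *
     \sum_(s <- permutations (rem x b)) linked C (map tr (x :: s)).
  move=> xb; rewrite /=.
  under eq_bigr do rewrite -mulnb; under [in RHS]eq_bigr do rewrite -mulnb.
  rewrite -!big_distrr /= IHn ?size_rem //; first by rewrite mulnCA.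
  - by rewrite -ltnS -addSn prednK.
  - by rewrite inE vC.
  - by rewrite (subseq_uniq _ bl_u) // cat_subseq ?rem_subseq.
rewrite (eq_big_seq _ edge) -big_distrr -sum_b.
rewrite [X in _ + X](_ : _ = size l * (size b + (size l).-1) ^_ (size l).-1 *
   \sum_(s <- permutations b) linked C (map tr s)); last by rewrite mulnC mulnA.
rewrite -mulnDl; congr (_ * _).
by rewrite -(prednK b_gt0) -(prednK l_gt0) /= ffact_pascal.
Qed.

(** No leaf edge can occur until a base edge covers [v]. That edge has index [find], counted from 0,
    which leaves [size b - (find _ s).+1] base edges to interleave freely with the leaf edges. *)
Lemma sum_linked (C : {set W}) (b l : seq T) :
  has (fun x => v \in tr x) b -> v \notin C -> uniq (b ++ l) ->
  {in l, forall x, tr x = [set v]} ->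
  \sum_(s <- permutations (b ++ l)) linked C (map tr s) =
  \sum_(s <- permutations b) linked C (map tr s) *
    ((size b - (find (fun x => v \in tr x) s).+1) + size l) ^_ (size l).
Proof.
have [n] := ubnP (size b); elim: n C b => // n IHn C b b_n b_v vC bl_u l_v.
have b_u : uniq b by move: bl_u; rewrite cat_uniq => /andP[].
have b_gt0 : 0 < size b by case: (b) b_v.
rewrite sum_permutations_cat ?addn_gt0 ?b_gt0 //.
(* A leaf edge in first position is disjoint from [C], so these terms vanish. *)
rewrite [X in _ + X]big_seq [X in _ + X]big1 ?addn0 => [|x xl]; last first.
  by rewrite big1 // => s _; rewrite /= l_v // disjoints1 vC.
rewrite [RHS]sum_permutations //; apply: eq_big_seq => x xb /=.
under eq_bigr do rewrite -mulnb.
under [RHS]eq_bigr do rewrite -mulnb -mulnA.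
rewrite -!big_distrr /=; congr (_ * _).
have bl_rem_u : uniq (rem x b ++ l).
  by rewrite (subseq_uniq _ bl_u) // cat_subseq ?rem_subseq.
have [vx | vx] := boolP (v \in tr x).
  rewrite sum_linked_covered ?inE ?vx ?orbT // size_rem // subn1 mulnC.
  by rewrite big_distrl.
rewrite IHn ?inE ?negb_or ?vC ?size_rem //; first last.
- move: b_v; rewrite (perm_has _ (perm_to_rem xb)) /= (negPf vx) //.
- by rewrite -ltnS prednK.
(* Removing a first edge that misses [v] lowers both [size b] and the index by one, so their
   difference is unchanged. *)
by apply: eq_bigr => s _; rewrite -(subn1 (size b)) -subnDA add1n.
Qed.

(** The two summands correspond to a base edge or a leaf edge coming first. In the second case [v]
    is covered at once, and the remaining leaf edges are free. *)
Lemma sum_chained (b l : seq T) :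
  has (fun x => v \in tr x) b -> uniq (b ++ l) ->
  {in l, forall x, tr x = [set v]} ->
  \sum_(s <- permutations (b ++ l)) chained (map tr s) =
  \sum_(s <- permutations b) chained (map tr s) *
    ((size b - (find (fun x => v \in tr x) s).+1) + size l) ^_ (size l) +
  size l * (size b + (size l).-1) ^_ (size l).-1 *
    \sum_(s <- permutations b) linked [set v] (map tr s).
Proof.
move=> b_v bl_u l_v.
have b_u : uniq b by move: bl_u; rewrite cat_uniq => /andP[].
have b_gt0 : 0 < size b by case: (b) b_v.
rewrite sum_permutations_cat ?addn_gt0 ?b_gt0 //; congr (_ + _).
  rewrite [RHS]sum_permutations //; apply: eq_big_seq => x xb /=.
  have bl_rem_u : uniq (rem x b ++ l).
    by rewrite (subseq_uniq _ bl_u) // cat_subseq ?rem_subseq.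
  have [vx | vx] := boolP (v \in tr x).
    by rewrite sum_linked_covered // size_rem // subn1 mulnC big_distrl.
  rewrite sum_linked ?size_rem //.
    by apply: eq_bigr => s _; rewrite -(subn1 (size b)) -subnDA add1n.
  by move: b_v; rewrite (perm_has _ (perm_to_rem xb)) /= (negPf vx).
have leaf x : x \in l ->
  \sum_(s <- permutations (b ++ rem x l)) chained (map tr (x :: s)) =
  (size b + (size l).-1) ^_ (size l).-1 *
    \sum_(s <- permutations b) linked [set v] (map tr s).
  move=> xl; rewrite /= l_v // sum_linked_covered ?size_rem ?inE //.
    by rewrite (subseq_uniq _ bl_u) // cat_subseq ?rem_subseq.
  by move=> y /mem_rem/l_v.
rewrite (eq_big_seq _ leaf) big_const_seq count_predT iter_addn_0.
by rewrite mulnC mulnA.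
Qed.

End FreeLeaves.

(** * Edges on four vertices as pairs of numbers *)

Section Pairs.
Local Open Scope nat_scope.

(** A counterpart of [linked] on plain numbers, so that the enumeration of base orderings can be
    evaluated by computation. *)
Fixpoint pairs_linked (c : seq nat) (s : seq (nat * nat)) : bool :=
  if s is p :: s' then
    ((p.1 \in c) || (p.2 \in c)) && pairs_linked [:: p.1, p.2 & c] s'
  else true.

Definition pairs_chained (s : seq (nat * nat)) : bool :=
  if s is p :: s' then pairs_linked [:: p.1; p.2] s' else true.

Definition pair_ends (x : nat) : pred (nat * nat) :=
  fun p => (x == p.1) || (x == p.2).

Definition pair_edge (p : nat * nat) : {set 'I_4} := [set inord p.1; inord p.2].

(** The strict order selects one of the two pairs encoding an edge, and the bound keeps [inord] away
    from its default value. *)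
Definition pair_lt4 : pred (nat * nat) := fun p => p.1 < p.2 < 4.

Lemma in_pair_edge p (x : 'I_4) :
  pair_lt4 p -> (x \in pair_edge p) = pair_ends x p.
Proof.
case/andP=> p12 p2; have p1 := ltn_trans p12 p2.
by rewrite !inE /pair_ends -!val_eqE /= !inordK.
Qed.

Lemma pair_edge_inj : {in pair_lt4 &, injective pair_edge}.
Proof.
move=> p q pP qP /setP eq_pq.
have ends x : x < 4 -> pair_ends x p = pair_ends x q.
  by move=> x4; have := eq_pq (Ordinal x4); rewrite !in_pair_edge.
case/andP: pP qP => p12 p2 /andP[q12 q2].
have [p1 q1] := (ltn_trans p12 p2, ltn_trans q12 q2).
have [ep1 ep2 eq1 eq2] := And4 (ends _ p1) (ends _ p2) (ends _ q1) (ends _ q2).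
move: ep1 ep2 eq1 eq2 p12 q12; rewrite /pair_ends.
case: p q {eq_pq ends p1 p2 q1 q2} => [x y] [z w] /= *.
by have [-> ->] : x = z /\ y = w by lia.
Qed.

Lemma linked_pair_edge (C : {set 'I_4}) (c : seq nat) s :
  (forall x, (x \in C) = (val x \in c)) -> all pair_lt4 s ->
  linked C (map pair_edge s) = pairs_linked c s.
Proof.
elim: s C c => //= p s IHs C c Cc /andP[p4 s4].
have [p1 p2] : p.1 < 4 /\ p.2 < 4 by case/andP: p4; lia.
congr (_ && _).
  rewrite /pair_edge -setI_eq0 setIUl setU_eq0 !setI_eq0 !disjoints1 negb_and.
  by rewrite !negbK !Cc /= !inordK.
apply: IHs => // x; rewrite inE in_pair_edge // Cc /pair_ends !inE.
by rewrite orbC orbA.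
Qed.

Lemma chained_pair_edge s :
  all pair_lt4 s -> chained (map pair_edge s) = pairs_chained s.
Proof.
case: s => //= p s /andP[p4 s4]; apply: linked_pair_edge => // x.
by rewrite in_pair_edge // /pair_ends !inE.
Qed.

Lemma perm_edges_graph4 E :
  uniq E -> all pair_lt4 E ->
  perm_eq (enum (edges (graph4 E))) (map pair_edge E).
Proof.
move=> E_u E4; apply: uniq_perm; first exact: enum_uniq.
  rewrite map_inj_in_uniq // => p q /(allP E4) p4 /(allP E4).
  exact: pair_edge_inj.
move=> e; rewrite mem_enum; apply/imsetP/mapP.
  case=> -[x y]; rewrite inE /= => /andP[_ /orP[] xyE ->].
    by exists (val x, val y); rewrite // /pair_edge !inord_val.
  by exists (val y, val x); rewrite // /pair_edge !inord_val setUC.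
case=> -[x y] xyE ->; have /andP[/= xy y4] := allP E4 _ xyE.
have x4 := ltn_trans xy y4.
exists (inord x, inord y); rewrite // inE /= /pairs_adj -val_eqE /= !inordK //.
by rewrite xyE (ltn_eqF xy).
Qed.

End Pairs.

(** * The one-tree probability for a base graph on four vertices *)

Section BaseGraph4.
Variables (E : seq (nat * nat)) (v : 'I_4) (a : nat).
Hypotheses (E_u : uniq E) (E4 : all pair_lt4 E).
Hypothesis E_cover : all (fun x => has (pair_ends x) E) (iota 0 4).
Local Notation m := (size E).
Local Notation G := (add_leaves (v : vertex (graph4 E)) a).

Lemma no_isolated_add_leaves (x : vertex G) : exists y, adj x y.
Proof.
case: x => [x|i]; last by exists (inl v); rewrite /= eqxx.
have /hasP[p pE xp] : has (pair_ends x) E.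
  by apply: (allP E_cover); rewrite mem_iota /=.
have /andP[p12 p2] := allP E4 _ pE; have p1 := ltn_trans p12 p2.
case/orP: xp => /eqP def_x.
  exists (inl (inord p.2)); rewrite /= /pairs_adj -val_eqE /= inordK // def_x.
  by rewrite (ltn_eqF p12) -surjective_pairing pE.
exists (inl (inord p.1)); rewrite /= /pairs_adj -val_eqE /= inordK // def_x.
by rewrite (gtn_eqF p12) -surjective_pairing pE orbT.
Qed.

(** One-tree orderings are those with chained traces, which [sum_chained] counts; the base orderings
    are then transported to pairs of numbers. *)
Lemma count_one_tree :
  count (fun s => num_trees s == 1%N) (orderings G) =
  (\sum_(s <- permutations E) pairs_chained s *
      ((m - (find (pair_ends v) s).+1) + a) ^_ a +
   a * (m + a.-1) ^_ a.-1 * count (pairs_linked [:: val v]) (permutations E))%N.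
Proof.
pose h p := base_edge a (pair_edge p : {set vertex (graph4 E)}).
pose tr := @trace (graph4 E) a.
pose b := map h E.
pose l := map (@leaf_edge (graph4 E) v a) (enum 'I_a).
have edges_bl : perm_eq (enum (edges G)) (b ++ l).
  rewrite (perm_trans (perm_edges_add_leaves _ _)) // perm_cat2r.
  rewrite [b](map_comp (@base_edge (graph4 E) a) pair_edge) perm_map //.
  exact: perm_edges_graph4.
have sz_l : size l = a by rewrite size_map size_enum_ord.
have bl_u : uniq (b ++ l) by rewrite -(perm_uniq edges_bl) enum_uniq.
have permE s : s \in permutations E -> all pair_lt4 s.
  by rewrite mem_permutations => /perm_all->.
have l_v : {in l, forall x, tr x = [set v]}.
  by move=> _ /mapP[i _ ->]; apply: trace_leaf_edge.
transitivity (\sum_(s <- permutations (b ++ l)) chained (map tr s))%N.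
  rewrite -(perm_big _ (perm_permutations edges_bl)) -sum1_count big_mkcond /=.
  apply: eq_big_seq => s; rewrite mem_permutations => s_ord.
  rewrite (@num_trees_eq1 G s s_ord (inl v) no_isolated_add_leaves).
  by rewrite (@chained_trace (graph4 E) v a s s_ord); case: (chained _).
rewrite (sum_chained (v := v)) //; last first.
  rewrite has_map; apply/hasP.
  have /hasP[p pE vp]: has (pair_ends v) E.
    by apply: (allP E_cover); rewrite mem_iota /=.
  exists p => //; rewrite /= /tr /h base_edgeK.
  by rewrite in_pair_edge ?(allP E4).
have b_u : uniq b by move: bl_u; rewrite cat_uniq => /andP[].
have tr_h p : tr (h p) = pair_edge p by exact: base_edgeK.
have trE t : map tr (map h t) = map pair_edge t.
  by rewrite -map_comp; apply: eq_map => p; apply: tr_h.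
rewrite sz_l !sum_permutations_map // size_map; congr (_ + _ * _)%N.
  apply: eq_big_seq => s /permE s4; rewrite trE chained_pair_edge //.
  rewrite find_map (eq_in_find (a2 := pair_ends v)) // => p ps /=.
  by rewrite tr_h in_pair_edge // (allP s4).
rewrite -sum1_count [in RHS]big_mkcond /=; apply: eq_big_seq => s /permE s4.
rewrite trE (@linked_pair_edge _ [:: val v]) // => x.
by rewrite !inE.
Qed.

(* Entry t counts the one-tree orderings in which v is first covered by the
   edge number t, counting from 0. *)
Definition first_hits : seq nat :=
  [seq count (fun s => pairs_chained s && (find (pair_ends v) s == t))
             (permutations E) | t <- iota 0 m].

(** Orderings in the first sum of [count_one_tree] are grouped by the index [t] at which [v] is
    first covered, and everything is divided by the number [(m + a)]! of orderings. *)
Lemma P_add_leaves :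
  P G 1 =
  \sum_(t < m) (nth 0%N first_hits t)%:R / ((m - t.+1)`!)%:R *
     (((m - t.+1) + a)`!%:R / (m + a)`!%:R) +
  (count (pairs_linked [:: val v]) (permutations E))%:R / m`!%:R *
     (a%:R / (a%:R + m%:R)) :> rat.
Proof.
have permE s : s \in permutations E -> (find (pair_ends v) s < m)%N.
  rewrite mem_permutations => sE; rewrite -(perm_size sE) -has_find.
  rewrite (perm_has _ sE).
  by apply: (allP E_cover); rewrite mem_iota /=.
have f_neq0 n : n`!%:R != 0 :> rat by rewrite pnatr_eq0 -lt0n fact_gt0.
rewrite /P count_one_tree.
have ->: size (orderings G) = (m + a)`!.
  rewrite size_permutations ?enum_uniq //.
  rewrite (perm_size (perm_edges_add_leaves _ _)).
  rewrite size_cat 2!size_map size_enum_ord.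
  rewrite (perm_size (perm_edges_graph4 _ _)) //.
  by rewrite size_map.
rewrite natrD mulrDl; congr (_ + _).
  transitivity (\sum_(t < m) (nth 0%N first_hits t * ((m - t.+1) + a) ^_ a)%:R
                  / (m + a)`!%:R : rat).
    rewrite -mulr_suml -natr_sum; congr (_%:R / _).
    (* Each entry of [first_hits] is expanded as a sum over orderings. After exchanging the sums, an
       ordering contributes only at its own index [t]. *)
    under [RHS]eq_bigr => t _.
      rewrite /first_hits (nth_map 0%N) ?size_iota // nth_iota // add0n.
      rewrite -sum1_count big_distrl /= big_mkcond /=; over.
    rewrite exchange_big; apply: eq_big_seq => s /permE s_m /=.
    rewrite (bigD1 (Ordinal s_m)) //= eqxx andbT big1 ?addn0 => [|t /negPf t_s].
      by case: (pairs_chained s); rewrite ?mul1n.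
    by rewrite eq_sym (_ : (t == _ :> nat) = false) ?andbF.
  apply: eq_bigr => t _; rewrite natrM.
  rewrite -[((m - t.+1) + a)`!](@ffact_fact _ a) ?leq_addl //.
  by rewrite addnK natrM; field; rewrite !f_neq0.
(* For [a = 0] the predecessor [a.-1] is truncated, but the factor [a] makes both sides 0. *)
case: (a) => [|k] /=; first by rewrite !mul0n !mul0r mulr0.
rewrite addnS factS -(@ffact_fact (m + k) k) ?leq_addl // addnK !natrM.
have ffn0 : ((m + k) ^_ k)%:R != 0 :> rat.
  by rewrite pnatr_eq0 -lt0n ffact_gt0 leq_addl.
have mk : k.+1%:R + m%:R = (m + k).+1%:R :> rat by rewrite -natrD addnC addnS.
by rewrite mk; field; rewrite f_neq0 ffn0 -natrD nat1r pnatr_eq0.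
Qed.

End BaseGraph4.

(** * Evaluation for the paw, the diamond and the complete graph *)

Theorem theorem4 (a : nat) :
  [/\ P (Paw a) 1 = 1 / 6 - 1 / (a%:R + 3) + 1 / (a%:R + 1),
      P (Di a) 1 = 3 / 10 - 2 / (a%:R + 4) + 2 / (a%:R + 2)
    & P (K4_leaves a) 1 = 2 / 5 - 3 / (a%:R + 5) + 3 / (a%:R + 3)].
Proof.
have f_neq0 : a`!%:R != 0 :> rat by rewrite pnatr_eq0 -lt0n fact_gt0.
have a_neq0 n : (a%:R + n.+1%:R : rat) != 0 by rewrite -natrD pnatr_eq0 addnS.
have a1_neq0 : a%:R + 1 != 0 :> rat by exact: (a_neq0 0).
(* Unrolls all the factorials down to a common [a]!, which [field] cancels. *)
have factDS n : (n.+1 + a)`!%:R = (a%:R + n.+1%:R) * (n + a)`!%:R :> rat.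
  by rewrite addSn factS natrM -addSn natrD addrC.
split.
- rewrite [LHS]P_add_leaves //.
  rewrite (_ : first_hits _ _ = [:: 4; 4; 6; 6]%N); last by vm_compute.
  (* This equals entry 0 of [first_hits]: being linked from the attachment vertex means being
     chained with a first edge at that vertex. The same holds for the other two graphs. *)
  rewrite (_ : count _ _ = 4%N); last by vm_compute.
  rewrite !big_ord_recl big_ord0 /= /bump /= !subSS !subn0 !factDS add0n.
  rewrite !factS fact0 !natrM.
  by field; rewrite f_neq0 a1_neq0 !a_neq0.
- rewrite [LHS]P_add_leaves //.
  (* The last entry is 0 because the attachment vertex has degree 2, so the final edge cannot be the
     first to cover it. In [K4], where the degree is 3, the last two entries vanish. *)
  rewrite (_ : first_hits _ _ = [:: 36; 24; 24; 12; 0]%N); last by vm_compute.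
  rewrite (_ : count _ _ = 36%N); last by vm_compute.
  rewrite !big_ord_recl big_ord0 /= /bump /= !subSS !subn0 !factDS add0n.
  rewrite !factS fact0 !natrM.
  by field; rewrite f_neq0 a1_neq0 !a_neq0.
- rewrite [LHS]P_add_leaves //.
  rewrite (_ : first_hits _ _ = [:: 288; 144; 108; 36; 0; 0]%N);
    last by vm_compute.
  rewrite (_ : count _ _ = 288%N); last by vm_compute.
  rewrite !big_ord_recl big_ord0 /= /bump /= !subSS !subn0 !factDS add0n.
  rewrite !factS fact0 !natrM.
  by field; rewrite f_neq0 a1_neq0 !a_neq0.
Qed.
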